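(* There does not exist a structure of a finite-dimensional topological vector space over $\mathbb R$ on the space $\mathbb H$; that is, there is no finite-dimensional topological vector space over $\mathbb R$ that is homeomorphic to $\mathbb H$.
   Context: Fix a real constant $\varkappa>0$. The space of all Keplerian orbits is $$\mathbb H=\{(\mathbf c,\mathbf e,h)\in\mathbb R^3\times\mathbb R^3\times\mathbb R=\mathbb R^7 : \mathbf c\cdot\mathbf e=0,\ 2h|\mathbf c|^2-\varkappa^4(|\mathbf e|^2-1)=0\},$$ where $\cdot$ is the standard inner product and $|\cdot|$ the Euclidean norm on $\mathbb R^3$. It carries the metric and topology induced from $\mathbb R^7$. *)

(* Defs.v *)
From mathcomp Require Import all_boot all_order all_algebra.
From mathcomp Require Import all_classical all_reals all_analysis.

Set Implicit Arguments.
Unset Strict Implicit.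
Unset Printing Implicit Defensive.

Import Order.TTheory GRing.Theory Num.Theory.
Import numFieldNormedType.Exports.

Local Open Scope classical_set_scope.
Local Open Scope ring_scope.

Definition dotv (R : realType) (n : nat) (u v : 'rV[R]_n) : R :=
  \sum_(i < n) u 0 i * v 0 i.

(* Not the library norm [`|u|] on row vectors, which is the sup norm. *)
Definition enorm (R : realType) (n : nat) (u : 'rV[R]_n) : R :=
  Num.sqrt (dotv u u).

(* The product topology on R^3 * R^3 * R is the Euclidean topology of R^7;
   [set_type (kepler_orbits k)] then carries the induced topology. *)
Definition kepler_orbits (R : realType) (k : R) :
    set ('rV[R]_3 * 'rV[R]_3 * R) :=
  [set x | let: (c, e, h) := x in
     dotv c e = 0 /\
     2 * h * enorm c ^+ 2 - k ^+ 4 * (enorm e ^+ 2 - 1) = 0].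

Definition homeomorphic (X Y : topologicalType) : Prop :=
  exists (f : X -> Y) (g : Y -> X),
    [/\ cancel f g, cancel g f, continuous f & continuous g].

(* [Vector.axiom n V] is the type of linear bijections from V to 'rV[R]_n. *)
Definition finite_dimensional (R : realType) (V : lmodType R) : Prop :=
  exists n : nat, inhabited (Vector.axiom n V).

(* Main.v *)
Require Import Defs.
From mathcomp Require Import all_boot all_order all_algebra.
From mathcomp Require Import all_classical all_reals all_analysis.
From mathcomp Require Import ring lra.
Import Order.TTheory GRing.Theory Num.Theory.
Import numFieldNormedType.Exports.
Local Open Scope classical_set_scope.
Local Open Scope ring_scope.

(** The space of orbits is not contractible, whereas a topological vector
    space is.  On orbits the vector c + e never vanishes: c and e are
    orthogonal, so c + e = 0 forces c = e = 0, and then the energy relation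
    reads k^4 = 0.  On the collision orbits (0, x, 0), |x| = 1, the vector
    c + e is x.  Thus a contraction of the orbit space would contract the unit
    sphere S^2 inside R^3 minus the origin ([no_sphere_contraction]), and it
    remains to show that this is impossible.

    A nonzero vector x of R^3 acts on C^2 through the
    Pauli matrices, and its eigenvectors for the eigenvalue |x| (the spinors of
    x) form a complex line; this is the tautological line bundle over S^2.
    When y is not opposite to x, projecting a spinor of x onto the eigenline of
    y gives a nonzero spinor of y ([spinor_project]).  Along a family of
    paths subdivided finely enough, a uniform subdivision being given by
    compactness, the iterated projections yield spinors that depend
    continuously on the endpoint ([transport]).  A contraction of S^2 therefore
    yields a continuous nonvanishing spinor field (s1, s2) on S^2.  There s1
    has no zero on the northern hemisphere and s2 has none on the southern one,
    while s2 = z s1 on the equator, z being the equatorial point.  Gluing the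
    two hemispheres as discs, conj(s1) s2 is a nonvanishing map from the disc
    to C that is a positive multiple of z at each point z of the circle.

    Such a map does not exist ([no_retraction_to_circle]).  The same transport,
    applied to real spinors of vectors in a plane, which are square roots up to
    a positive factor, turns it into a continuous square root of z on the
    circle, again up to a positive factor.  The square roots of z and of - z are orthogonal, so their cross
    product has no zero; but it is an odd function of z, and the intermediate
    value theorem on a half circle gives it one ([no_circle_sqrt]). *)

(** * Continuity of explicit formulas *)

Section ContinuityRules.
Context {X : topologicalType}.

Lemma continuous_after (Y Z : topologicalType) (g : Y -> Z) (f : X -> Y) :
  continuous g -> continuous f -> continuous (fun x => g (f x)).
Proof. by move=> cg cf x; apply: continuous_comp; [exact: cf|exact: cg]. Qed.

Lemma continuous_pairing (Y Z : topologicalType) (f : X -> Y) (g : X -> Z) :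
  continuous f -> continuous g -> continuous (fun x => (f x, g x)).
Proof. by move=> cf cg x; apply: cvg_pair; [exact: cf|exact: cg]. Qed.

Lemma continuous_fst (Y Z : topologicalType) (f : X -> Y * Z) :
  continuous f -> continuous (fun x => (f x).1).
Proof. by apply: (continuous_after _ _ fst) => y; exact: cvg_fst. Qed.

Lemma continuous_snd (Y Z : topologicalType) (f : X -> Y * Z) :
  continuous f -> continuous (fun x => (f x).2).
Proof. by apply: (continuous_after _ _ snd) => y; exact: cvg_snd. Qed.

Lemma continuous_const (Y : topologicalType) (y : Y) :
  continuous (fun _ : X => y).
Proof. by move=> x; exact: cvg_cst. Qed.

Lemma continuous_self : continuous (fun x : X => x).
Proof. by move=> x; exact: cvg_id. Qed.

Context {R : realType}.
Implicit Types f g : X -> R.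

Lemma continuous_add (V : normedModType R) (f g : X -> V) :
  continuous f -> continuous g -> continuous (fun x => f x + g x).
Proof. by move=> cf cg x; apply: cvgD; [exact: cf|exact: cg]. Qed.

Lemma continuous_opp f : continuous f -> continuous (fun x => - f x).
Proof. by move=> cf x; apply: cvgN; exact: cf. Qed.

Lemma continuous_mul f g :
  continuous f -> continuous g -> continuous (fun x => f x * g x).
Proof. by move=> cf cg x; apply: cvgM; [exact: cf|exact: cg]. Qed.

Lemma continuous_sqrt f : continuous f -> continuous (fun x => Num.sqrt (f x)).
Proof. exact/continuous_after/sqrt_continuous. Qed.

Lemma continuous_scale (V : topologicalLmodType R) f (g : X -> V) :
  continuous f -> continuous g -> continuous (fun x => f x *: g x).
Proof.
move=> cf cg; exact: (@continuous_after (R^o * V)%type V (fun z => z.1 *: z.2)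
  (fun x => (f x : R^o, g x)) (@scale_continuous R V)
  (continuous_pairing _ _ _ _ cf cg)).
Qed.

End ContinuityRules.

(** Rules are chosen by the head of the body of the function: letting
    unification pick them unfolds the product topology and does not scale. *)
Ltac continuity :=
  repeat first [ assumption
  | lazymatch goal with |- forall y, continuous_at y ?f =>
  lazymatch f with
  | (fun _ => ?c) => exact: (continuous_const _ c)
  | (fun x => x) => exact: continuous_self
  | fst => exact: (continuous_fst _ _ _ continuous_self)
  | snd => exact: (continuous_snd _ _ _ continuous_self)
  | (fun x => @?a x + @?b x) => refine (continuous_add _ a b _ _)
  | (fun x => - @?a x) => refine (continuous_opp a _)
  | (fun x => @?a x * @?b x) => refine (continuous_mul a b _ _)
  | (fun x => @?a x *: @?b x) => refine (continuous_scale _ a b _ _)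
  | (fun x => Num.sqrt (@?a x)) => refine (continuous_sqrt a _)
  | (fun x => (@?a x, @?b x)) => refine (continuous_pairing _ _ a b _ _)
  | (fun x => (@?a x).1) => refine (continuous_fst _ _ a _)
  | (fun x => (@?a x).2) => refine (continuous_snd _ _ a _)
  end end ].

(** * Lifting along the rays of a vector space *)

(** Path lifting for the family of all rays t |-> W (t v), from t = 0 to t = 1.
    A path in B is lifted to E by a discrete connection: [step] moves a lift of
    one point to a lift of a nearby point, nearness being the positivity of
    the continuous function [close].  By compactness one mesh 1/(n+1) makes
    consecutive points of all rays through K close, and n+1 steps reach W v;
    being a finite composition of continuous maps, the result is continuous in
    v. *)
Lemma transport (R : realType) (V : topologicalLmodType R)
    (B E : topologicalType) (lift : E -> B -> Prop)
    (close : B * B -> R) (step : B * E -> E) :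
  continuous close -> continuous step ->
  (forall s x y, lift s x -> 0 < close (x, y) -> lift (step (y, s)) y) ->
  forall (W : V -> B) (K : set V), continuous W -> compact K ->
  (forall v t, K v -> 0 <= t <= 1 -> 0 < close (W (t *: v), W (t *: v))) ->
  forall s0, lift s0 (W 0) ->
  exists2 s : V -> E, continuous s & forall v, K v -> lift (s v) (W v).
Proof.
move=> cclose cstep stepP W K cW cK Wpos s0 s0P.
pose Wt (t : R) v := W (t *: v).
(* Compactness turns closeness at time lag h = 0 into closeness for all small h,
   uniformly on K and on the unit interval. *)
have cP : \forall h \near (0 : R), K `*` `[0, 1] `<=`
    [set z : V * R | 0 < close (Wt z.2 z.1, Wt (z.2 + h) z.1)].
  have /compact_near_coveringP cov := compact_setX cK (@segment_compact R 0 1).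
  apply: (cov _ _ (fun h z => 0 < close (Wt z.2 z.1, Wt (z.2 + h) z.1))
    (nbhs_filter 0)).
  move=> [v t] [/= Kv]; rewrite in_itv /= => t01.
  have cF : continuous (fun z : (V * R) * R =>
      close (Wt z.1.2 z.1.1, Wt (z.1.2 + z.2) z.1.1)).
    apply: continuous_after => //.
    by apply: continuous_pairing; apply: continuous_after => //; continuity.
  have := cvgr_gt _ (cF (v, t, 0)) 0; apply.
  by rewrite /= addr0; apply: Wpos.
have [n nP] : exists n : nat, K `*` `[0, 1] `<=`
    [set z : V * R | 0 < close (Wt z.2 z.1, Wt (z.2 + n.+1%:R^-1) z.1)].
  have := @cvg_harmonic R _ cP.
  by case=> n _ /(_ n (leqnn n)) nP; exists n.
pose s := fix s k v := if k is k'.+1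
  then step (Wt (k%:R * n.+1%:R^-1) v, s k' v) else s0.
exists (s n.+1).
  elim: n.+1 => [|k IH] /=; first exact: continuous_const.
  apply: continuous_after => //; apply: continuous_pairing => //.
  apply: (continuous_after _ _ W) => //.
  by apply: (continuous_scale _ (fun=> _) id); continuity.
move=> v Kv.
suff H k : (k <= n.+1)%N -> lift (s k v) (Wt (k%:R * n.+1%:R^-1) v).
  by have := H _ (leqnn _); rewrite divff ?pnatr_eq0// /Wt scale1r.
elim: k => [_|k IH kn] /=; first by rewrite mul0r /Wt scale0r.
apply: stepP (IH (ltnW kn)) _.
have := nP (v, k%:R * n.+1%:R^-1); rewrite /= -[X in _ + X]mul1r -mulrDl natr1.
apply; split=> //=.
by rewrite in_itv /= divr_ge0//= ler_pdivrMr// mul1r ler_nat ltnW.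
Qed.

(** * Spinors *)

Section Spinors.
Context {R : realType}.
Implicit Types (x y : R * R * R) (s t : R * R * R * R).

Definition dot3 x y : R := x.1.1 * y.1.1 + x.1.2 * y.1.2 + x.2 * y.2.

Definition norm3 x : R := Num.sqrt (dot3 x x).

Definition dot4 s t : R :=
  s.1.1.1 * t.1.1.1 + s.1.1.2 * t.1.1.2 + s.1.2 * t.1.2 + s.2 * t.2.

(** The action of the traceless Hermitian matrix with rows (x3, x1 - i x2) and
    (x1 + i x2, - x3), that is of the Pauli matrices, on the element
    (a + i b, c + i d) of C^2 written as the tuple (a, b, c, d). *)
Definition clifford x s : R * R * R * R :=
  (x.2 * s.1.1.1 + x.1.1 * s.1.2 + x.1.2 * s.2,
   x.2 * s.1.1.2 + x.1.1 * s.2 - x.1.2 * s.1.2,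
   x.1.1 * s.1.1.1 - x.1.2 * s.1.1.2 - x.2 * s.1.2,
   x.1.1 * s.1.1.2 + x.1.2 * s.1.1.1 - x.2 * s.2).

Definition scale4 (a : R) s : R * R * R * R :=
  (a * s.1.1.1, a * s.1.1.2, a * s.1.2, a * s.2).

Definition add4 s t : R * R * R * R :=
  (s.1.1.1 + t.1.1.1, s.1.1.2 + t.1.1.2, s.1.2 + t.1.2, s.2 + t.2).

Definition spinor s x : Prop :=
  0 < dot4 s s /\ clifford x s = scale4 (norm3 x) s.

(** Twice the norm of z.1 times the orthogonal projection of z.2 onto the
    eigenspace for the eigenvalue [norm3 z.1]. *)
Definition project (z : (R * R * R) * (R * R * R * R)) : R * R * R * R :=
  add4 (scale4 (norm3 z.1) z.2) (clifford z.1 z.2).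

Lemma dot3_ge0 x : 0 <= dot3 x x.
Proof. by rewrite /dot3 !addr_ge0// -expr2 sqr_ge0. Qed.

Lemma dot3_le0 x : dot3 x x <= 0 -> [/\ x.1.1 = 0, x.1.2 = 0 & x.2 = 0].
Proof.
have sq0 (a b : R) : 0 <= b -> a * a + b <= 0 -> a = 0.
  by move=> b0 ab; apply/eqP; rewrite -sqrf_eq0 expr2; apply/eqP; nra.
rewrite /dot3 => x0; split.
- by apply: (sq0 _ (x.1.2 * x.1.2 + x.2 * x.2)); nra.
- by apply: (sq0 _ (x.1.1 * x.1.1 + x.2 * x.2)); nra.
- by apply: (sq0 _ (x.1.1 * x.1.1 + x.1.2 * x.1.2)); nra.
Qed.

Lemma norm3_sqr x : norm3 x * norm3 x = dot3 x x.
Proof. by rewrite -expr2 sqr_sqrtr// dot3_ge0. Qed.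

Lemma dot3_gt0l x y : 0 < dot3 x y -> 0 < dot3 x x.
Proof.
rewrite !ltNge; apply: contraNN => /dot3_le0[e1 e2 e3].
by rewrite /dot3 e1 e2 e3 !mul0r !addr0.
Qed.

Lemma dot3C x y : dot3 x y = dot3 y x.
Proof. by rewrite /dot3; ring. Qed.

(** The Clifford relation, polarized: the operators of x and y are symmetric and
    the symmetric part of their product is the scalar x.y. *)
Lemma clifford_dot4 x y s :
  dot4 (clifford x s) (clifford y s) = dot3 x y * dot4 s s.
Proof. by rewrite /dot4 /clifford /dot3 /=; ring. Qed.

Lemma clifford_sqr x s : clifford x (clifford x s) = scale4 (dot3 x x) s.
Proof. by rewrite /clifford /dot3 /scale4 /=; congr (_, _, _, _); ring. Qed.

Lemma cliffordD x a s t :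
  clifford x (add4 (scale4 a s) t) =
  add4 (scale4 a (clifford x s)) (clifford x t).
Proof.
by rewrite /clifford /add4 /scale4 /=; congr (_, _, _, _); ring.
Qed.

(** That the projection lands in the eigenspace of y is the relation
    [clifford_sqr]; that it does not vanish is quantitative: |x| |Py s|^2 is
    2 |y| (|x| |y| + x.y) |s|^2, where |x| <s, y s> = <x s, y s> = x.y |s|^2. *)
Lemma spinor_project s x y :
  spinor s x -> 0 < dot3 x y -> spinor (project (y, s)) y.
Proof.
move=> [s0 sx] xy0; have x0 := dot3_gt0l _ _ xy0.
have nx0 : 0 < norm3 x by rewrite sqrtr_gt0.
have ny0 : 0 < norm3 y by rewrite sqrtr_gt0 (dot3_gt0l _ x)// dot3C.
have ny2 := norm3_sqr y; split.
  have exy : norm3 x * dot4 s (clifford y s) = dot3 x y * dot4 s s.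
    by rewrite -clifford_dot4 sx /dot4 /=; ring.
  have yy := clifford_dot4 y y s; rewrite -ny2 in yy.
  have -> : dot4 (project (y, s)) (project (y, s)) =
      2 * norm3 y * (norm3 y * dot4 s s + dot4 s (clifford y s)).
    transitivity (norm3 y * norm3 y * dot4 s s
       + 2 * norm3 y * dot4 s (clifford y s)
       + dot4 (clifford y s) (clifford y s)).
      by rewrite /project /dot4 /=; ring.
    by rewrite yy; ring.
  rewrite pmulr_rgt0 ?mulr_gt0// -(pmulr_rgt0 _ nx0) mulrDr exy.
  by rewrite addr_gt0 ?mulr_gt0.
rewrite /project /= cliffordD clifford_sqr -ny2 /scale4 /add4 /=.
by congr (_, _, _, _); ring.
Qed.

(** Over the plane x2 = 0 the matrix of x is real, so a real spinor exists, and
    its projections over that plane stay real. *)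
Lemma spinor_exists x : 0 < dot3 x x ->
  exists2 s, spinor s x & x.1.2 = 0 -> s.1.1.2 = 0 /\ s.2 = 0.
Proof.
move=> x0; have n0 : 0 < norm3 x by rewrite sqrtr_gt0.
have := norm3_sqr x; rewrite /spinor.
case: x {x0} (norm3 x) n0 => -[x1 x2] x3 n n0; rewrite /dot3 /= => nE.
(* The projection of (1, 0), unless x is on the negative third axis. *)
have [t0|t0] := ltP 0 ((n + x3) * (n + x3) + x1 * x1 + x2 * x2).
  exists (n + x3, 0, x1, x2) => //=; split.
    by rewrite /dot4 /= mulr0 addr0.
  rewrite /clifford /scale4 /=.
  congr (_, _, _, _); [|ring|ring|ring].
  by rewrite [RHS]mulrDr nE; ring.
have [/= e1 e2 e3] := dot3_le0 (n + x3, x1, x2) t0.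
exists (0, 0, 1, 0) => //=; split; first by rewrite /dot4 /=; lra.
rewrite /clifford /scale4 /=.
by congr (_, _, _, _); nra.
Qed.

Lemma continuous_norm3 : continuous norm3.
Proof. by rewrite /norm3 /dot3; continuity. Qed.

Lemma continuous_project : continuous project.
Proof.
have cn (T : topologicalType) (f : T -> R * R * R) :
    continuous f -> continuous (fun z => norm3 (f z)).
  exact/continuous_after/continuous_norm3.
rewrite /project /add4 /scale4 /clifford /=.
by continuity; apply: cn; continuity.
Qed.

Lemma continuous_dot3 : continuous (fun z => dot3 z.1 z.2).
Proof. by rewrite /dot3; continuity. Qed.

End Spinors.

(** * No nonvanishing extension of the circle map to the disc *)

(** A square instead of the disc: it is star-shaped, its compactness is that of
    a product of segments, and it contains the unit circle. *)
Definition square (R : realType) : set (R * R) := `[-1, 1] `*` `[-1, 1].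

Lemma compact_square (R : realType) : compact (square R).
Proof. by apply: compact_setX; exact: segment_compact. Qed.

Lemma in_square (R : realType) (u : R * R) :
  square R u <-> (-1 <= u.1 <= 1) /\ (-1 <= u.2 <= 1).
Proof. by rewrite /square /= !in_itv. Qed.

Lemma square_scale (R : realType) (u : R * R) (t : R) :
  square R u -> 0 <= t <= 1 -> square R (t *: u).
Proof.
by rewrite !in_square => -[/andP[u1 u2] /andP[u3 u4]] /andP[t0 t1];
  split=> /=; apply/andP; split; rewrite /GRing.scale /=; nra.
Qed.

Lemma circle_in_square (R : realType) (u : R * R) :
  u.1 * u.1 + u.2 * u.2 = 1 -> square R u.
Proof. by move=> u1; rewrite in_square; split; apply/andP; split; nra. Qed.

Section Circle.
Context {R : realType}.
Implicit Types u : R * R.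

(** Here a + i c is a square root of u up to a positive factor.  Multiplying the
    square roots p + i q of u and p' + i q' of - u gives, after conjugating the
    second, a number of negative square; so its imaginary part does not vanish,
    although it changes sign between u and - u. *)
Lemma no_circle_sqrt (a c : R * R -> R) :
  continuous a -> continuous c ->
  (forall u, u.1 * u.1 + u.2 * u.2 = 1 -> exists2 l : R, 0 < l &
     a u * a u - c u * c u = l * u.1 /\ 2 * a u * c u = l * u.2) ->
  False.
Proof.
move=> ca cc sq.
pose arc (t : R) : R * R := (t, Num.sqrt (1 - t * t)).
pose anti (t : R) : R * R := (- t, - Num.sqrt (1 - t * t)).
pose K t := a (arc t) * c (anti t) - c (arc t) * a (anti t).
have carc : continuous arc by rewrite /arc; continuity.
have canti : continuous anti by rewrite /anti; continuity.
have cK : continuous K.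
  by rewrite /K; continuity; apply: continuous_after => //; continuity.
have K1 : K (-1) = - K 1.
  by rewrite /K /arc /anti !mulrNN !mulr1 subrr sqrtr0 opprK oppr0; ring.
have [t] : exists2 t : R, t \in `[-1, 1] & K t = 0.
  apply: IVT; first lra.
    exact: continuous_subspaceT.
  rewrite K1 ge_min le_max oppr_le0 oppr_ge0.
  by case: (lerP 0 (K 1)) => [_|/ltW ->]; rewrite ?orbT.
rewrite in_itv /= => /andP[t0 t1] Kt.
have w2 : Num.sqrt (1 - t * t) * Num.sqrt (1 - t * t) = 1 - t * t.
  by rewrite -expr2 sqr_sqrtr//; nra.
have [|l l0 [e1 e2]] := sq (arc t); first by rewrite /= w2; ring.
have [|m m0 [e3 e4]] := sq (anti t); first by rewrite /= !mulrNN w2; ring.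
move: Kt e1 e2 e3 e4; rewrite /K /=.
move: (a (arc t)) (c (arc t)) (a (anti t)) (c (anti t)) => p q p' q' Kt.
move: (Num.sqrt _) w2 => w w2 e1 e2 e3 e4.
(* The real part of the square of (p + i q) conj(p' + i q'). *)
have : (p * p' + q * q') * (p * p' + q * q')
     - (p * q' - q * p') * (p * q' - q * p') = - (l * m).
  transitivity ((p * p - q * q) * (p' * p' - q' * q') +
                (2 * p * q) * (2 * p' * q')).
    by ring.
  rewrite e1 e2 e3 e4.
  transitivity (- (l * m) * (t * t + w * w)); first by ring.
  by rewrite w2; ring.
by rewrite Kt; have := mulr_gt0 l0 m0; nra.
Qed.

(** The spinors of (x2, 0, x1) that are real are the vectors (a, c) such that
    (a + i c)^2 is a positive multiple of x1 + i x2: half-angle vectors.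
    Transporting them along the rays of the square from the centre gives a
    square root of f, hence of u on the circle. *)
Lemma no_retraction_to_circle (f : R * R -> R * R) :
  continuous f ->
  (forall u, square R u -> 0 < (f u).1 * (f u).1 + (f u).2 * (f u).2) ->
  (forall u, u.1 * u.1 + u.2 * u.2 = 1 ->
     exists2 l : R, 0 < l & f u = (l * u.1, l * u.2)) ->
  False.
Proof.
move=> cf f0 fcirc.
pose j (x : R * R) : R * R * R := (x.2, 0, x.1).
have cj : continuous j by rewrite /j; continuity.
pose lift (s : R * R * R * R) (x : R * R) :=
  spinor s (j x) /\ (s.1.1.2 = 0 /\ s.2 = 0).
have jj x : dot3 (j x) (j x) = x.1 * x.1 + x.2 * x.2.
  by rewrite /dot3 /j /=; ring.
have [s0 s0P s0r] : exists2 s, spinor s (j (f 0)) &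
    (j (f 0)).1.2 = 0 -> s.1.1.2 = 0 /\ s.2 = 0.
  apply: spinor_exists; rewrite jj; apply: f0.
  by rewrite in_square /= lerN10 ler01.
have [||s x y [sx [s1 s2]] xy|u t uK t01||s cs sP] :=
    transport _ (R * R)%type _ _ lift
      (fun z => dot3 (j z.1) (j z.2)) (fun z => project (j z.1, z.2))
      _ _ _ f (square R) cf (compact_square R) _ s0.
- apply: (continuous_after _ _ (fun z => dot3 z.1 z.2)
    (fun z => (j z.1, j z.2))).
    exact: continuous_dot3.
  by apply: continuous_pairing; apply: continuous_after => //; continuity.
- apply: continuous_after; first exact: continuous_project.
  by continuity; apply: continuous_after => //; continuity.
- split; first exact: spinor_project sx xy.
  by rewrite /project /= s1 s2; split; ring.
- by rewrite jj; apply/f0/square_scale.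
- by split=> //; exact: s0r.
apply: (no_circle_sqrt (fun u => (s u).1.1.1) (fun u => (s u).1.2)).
- by continuity.
- by continuity.
move=> u u1.
have [[s_gt0 sE] [s1 s2]] := sP _ (circle_in_square _ _ u1).
have [l l0 fE] := fcirc _ u1.
have n0 : 0 < norm3 (j (f u)).
  by rewrite sqrtr_gt0 jj f0//; exact: circle_in_square.
move: sE s_gt0; rewrite /clifford /scale4 /dot4 s1 s2 => -[].
move=> /=; move: (norm3 _) n0 (s u).1.1.1 (s u).1.2 => n n0 a c.
rewrite fE /= => e1 _ e3 _ ac0.
(* With l, n, a, c as here, (a + i c)^2 = l (a^2 + c^2) / n * (u1 + i u2). *)
have ninv : n * n^-1 = 1 by rewrite divff// gt_eqF.
exists (l * (a * a + c * c) * n^-1).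
  by rewrite !mulr_gt0 ?invr_gt0//; move: ac0; rewrite mulr0 !addr0.
split.
  transitivity ((a * (n * a) - c * (n * c)) * n^-1).
    transitivity ((a * a - c * c) * (n * n^-1)); last by ring.
    by rewrite ninv mulr1.
  by rewrite -e1 -e3; ring.
transitivity ((c * (n * a) + a * (n * c)) * n^-1).
  transitivity (2 * a * c * (n * n^-1)); last by ring.
  by rewrite ninv mulr1.
by rewrite -e1 -e3; ring.
Qed.
End Circle.

(** * The sphere is not contractible in the punctured space *)

Section Sphere.
Context {R : realType}.

(** A spinor (s1, s2) satisfies (|x| + x3) s2 = (x1 + i x2) s1 and
    (|x| - x3) s1 = (x1 - i x2) s2, so s1 can only vanish at the south pole and
    s2 only at the north pole. *)
Lemma spinor_upper_neq0 (s : R * R * R * R) (x : R * R * R) :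
  spinor s x -> 0 < norm3 x + x.2 ->
  0 < s.1.1.1 * s.1.1.1 + s.1.1.2 * s.1.1.2.
Proof.
move=> [s0 [_ _ e3 e4]] nx0; rewrite ltNge; apply: contraTN s0 => ab.
have [|/= a0 b0 _] := @dot3_le0 R (s.1.1.1, s.1.1.2, 0).
  by rewrite /dot3 /= mulr0 addr0.
have c0 : s.1.2 = 0.
  by apply: (mulfI (lt0r_neq0 nx0)); rewrite mulrDl -e3 a0 b0; ring.
have d0 : s.2 = 0.
  by apply: (mulfI (lt0r_neq0 nx0)); rewrite mulrDl -e4 a0 b0; ring.
by rewrite /dot4 a0 b0 c0 d0 mulr0 !addr0 ltxx.
Qed.

Lemma spinor_lower_neq0 (s : R * R * R * R) (x : R * R * R) :
  spinor s x -> 0 < norm3 x - x.2 -> 0 < s.1.2 * s.1.2 + s.2 * s.2.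
Proof.
move=> [s0 [e1 e2 _ _]] nx0; rewrite ltNge; apply: contraTN s0 => cd.
have [|/= c0 d0 _] := @dot3_le0 R (s.1.2, s.2, 0).
  by rewrite /dot3 /= mulr0 addr0.
have a0 : s.1.1.1 = 0.
  by apply: (mulfI (lt0r_neq0 nx0)); rewrite mulrBl -e1 c0 d0; ring.
have b0 : s.1.1.2 = 0.
  by apply: (mulfI (lt0r_neq0 nx0)); rewrite mulrBl -e2 c0 d0; ring.
by rewrite /dot4 a0 b0 c0 d0 mulr0 !addr0 ltxx.
Qed.

(** Stereographic parametrization, from the south pole for e = 1 and from the
    north pole for e = -1; both are the identity on the equator.  Being defined
    on the whole plane, it avoids maps on subspaces. *)
Definition stereo (e : R) (u : R * R) : R * R * R :=
  let r := u.1 * u.1 + u.2 * u.2 in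
  (2 * u.1 * (1 + r)^-1, 2 * u.2 * (1 + r)^-1, e * (1 - r) * (1 + r)^-1).

Lemma stereo_denom (u : R * R) : 0 < 1 + (u.1 * u.1 + u.2 * u.2).
Proof. by nra. Qed.

Lemma continuous_stereo e : continuous (stereo e).
Proof.
have cinv : continuous (fun u : R * R => (1 + (u.1 * u.1 + u.2 * u.2))^-1).
  move=> u.
  apply: (@cvgV _ _ _ _ (fun u : R * R => 1 + (u.1 * u.1 + u.2 * u.2))).
    by rewrite gt_eqF// stereo_denom.
  move: u; change (continuous (fun u : R * R => 1 + (u.1 * u.1 + u.2 * u.2))).
  by continuity.
by rewrite /stereo; continuity.
Qed.

Lemma stereo_dot3 e u : e * e = 1 -> dot3 (stereo e u) (stereo e u) = 1.
Proof.
move=> e1; have := divff (lt0r_neq0 (stereo_denom u)).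
rewrite /dot3 /stereo /=; move: (_^-1) => q; set r := _ + _ * _ => rq.
transitivity ((4 * r + e * e * ((1 - r) * (1 - r))) * q * q).
  by rewrite /r; ring.
rewrite e1; transitivity (((1 + r) * q) * ((1 + r) * q)); first by ring.
by rewrite rq mulr1.
Qed.

Lemma stereo_circle e u :
  u.1 * u.1 + u.2 * u.2 = 1 -> stereo e u = (u.1, u.2, 0).
Proof.
move=> u1; rewrite /stereo u1; congr (_, _, _);
  last by rewrite subrr mulr0 mul0r.
all: by rewrite mulrAC divff ?mul1r// lt0r_neq0// addr_gt0.
Qed.

(** N and S carry the two hemispheres into V, glued along the equator; the vector
    W (t v) contracts their image to the point W 0 as t goes to 0. *)
Lemma no_sphere_contraction (V : topologicalLmodType R)
    (W : V -> R * R * R) (N S : R * R -> V) :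
  continuous W -> continuous N -> continuous S ->
  (forall v, 0 < dot3 (W v) (W v)) ->
  (forall u, W (N u) = stereo 1 u) -> (forall u, W (S u) = stereo (-1) u) ->
  (forall u, u.1 * u.1 + u.2 * u.2 = 1 -> N u = S u) ->
  False.
Proof.
move=> cW cN cS W0 WN WS NS.
pose K := (N @` square R) `|` (S @` square R).
have cK : compact K.
  by apply: compactU; apply: continuous_compact (compact_square R);
    exact: continuous_subspaceT.
have [s0 s0P _] := spinor_exists _ (W0 0).
have [s x y|u t _ _|s cs sP] :=
    transport _ V _ _ spinor (fun z => dot3 z.1 z.2) project
      continuous_dot3 continuous_project _ W K cW cK _ s0 s0P.
- exact: spinor_project.
- exact: W0.
have sN u : square R u -> spinor (s (N u)) (stereo 1 u).
  by move=> uQ; rewrite -WN; apply: sP; left; exists u.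
have sS u : square R u -> spinor (s (S u)) (stereo (-1) u).
  by move=> uQ; rewrite -WS; apply: sP; right; exists u.
have norm1 e u : e * e = 1 -> norm3 (stereo e u) = 1.
  by move=> e1; rewrite /norm3 stereo_dot3// sqrtr1.
have csN : continuous (fun u => s (N u)) by exact: continuous_after.
have csS : continuous (fun u => s (S u)) by exact: continuous_after.
(* conj(s1) s2, with s1 read in the north and s2 in the south. *)
pose f u : R * R :=
  let p := s (N u) in let q := s (S u) in
  (p.1.1.1 * q.1.2 + p.1.1.2 * q.2, p.1.1.1 * q.2 - p.1.1.2 * q.1.2).
apply: (no_retraction_to_circle f).
- by rewrite /f; continuity.
- move=> u uQ.
  have := spinor_upper_neq0 _ _ (sN _ uQ).
  have := spinor_lower_neq0 _ _ (sS _ uQ).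
  rewrite !norm1 ?mulr1 ?mulrNN ?mulr1//.
  have dd := divff (lt0r_neq0 (stereo_denom u)).
  have -> : 1 - (stereo (-1) u).2 = 2 * (1 + (u.1 * u.1 + u.2 * u.2))^-1.
    by rewrite /stereo /= -[X in X - _]dd; ring.
  have -> : 1 + (stereo 1 u).2 = 2 * (1 + (u.1 * u.1 + u.2 * u.2))^-1.
    by rewrite /stereo /= -[X in X + _ = _]dd; ring.
  have q0 : 0 < 2 * (1 + (u.1 * u.1 + u.2 * u.2))^-1.
    by rewrite mulr_gt0 ?invr_gt0 ?stereo_denom.
  move=> /(_ q0) lo /(_ q0) up; have := mulr_gt0 up lo.
  by congr (_ < _); rewrite /f /=; ring.
move=> u u1; have uQ := circle_in_square _ _ u1.
exists ((s (N u)).1.1.1 * (s (N u)).1.1.1 + (s (N u)).1.1.2 * (s (N u)).1.1.2).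
  apply: spinor_upper_neq0 (sN _ uQ) _.
  by rewrite norm1 ?mulr1// stereo_circle//= addr0.
have [_] := sN _ uQ.
rewrite norm1 ?mulr1// stereo_circle// /clifford /scale4 /=.
rewrite !mul0r !subr0 !mul1r => -[_ _ e3 e4].
by rewrite /f -NS// -e3 -e4; congr (_, _); ring.
Qed.

End Sphere.

(** * The space of orbits *)

Definition row3 (R : realType) (x : R * R * R) : 'rV[R]_3 :=
  x.1.1 *: delta_mx 0 0 + x.1.2 *: delta_mx 0 1 + x.2 *: delta_mx 0 2%:R.

Lemma continuous_row3 (R : realType) : continuous (@row3 R).
Proof. by rewrite /row3; continuity. Qed.

Lemma row3E (R : realType) (x : R * R * R) :
  [/\ row3 R x 0 0 = x.1.1, row3 R x 0 1 = x.1.2 & row3 R x 0 2%:R = x.2].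
Proof. by split; rewrite !mxE /= ?mulr1 ?mulr0 ?addr0 ?add0r. Qed.

Lemma dotv3E (R : realType) (c e : 'rV[R]_3) :
  dotv c e = c 0 0 * e 0 0 + c 0 1 * e 0 1 + c 0 2%:R * e 0 2%:R.
Proof.
rewrite /dotv !big_ord_recl big_ord0 addr0 addrA.
by congr (_ * _ + _ * _ + _ * _); congr (_ _ _); apply: val_inj.
Qed.

Lemma enorm_sqr (R : realType) n (c : 'rV[R]_n) : enorm c ^+ 2 = dotv c c.
Proof.
by rewrite sqr_sqrtr// sumr_ge0// => i _; rewrite -expr2 sqr_ge0.
Qed.

Definition vector_sum (R : realType) (x : 'rV[R]_3 * 'rV[R]_3 * R) :
    R * R * R :=
  (x.1.1 0 0 + x.1.2 0 0, x.1.1 0 1 + x.1.2 0 1, x.1.1 0 2%:R + x.1.2 0 2%:R).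

Lemma continuous_vector_sum (R : realType) : continuous (vector_sum R).
Proof.
have cc i (g : 'rV[R]_3 * 'rV[R]_3 * R -> 'rV[R]_3) :
    continuous g -> continuous (fun x => g x 0 i).
  apply: (continuous_after _ _ (fun M : 'rV[R]_3 => M 0 i)).
  exact: coord_continuous.
by rewrite /vector_sum; continuity; apply: cc; continuity.
Qed.

(** If c = - e then c.e = 0 gives e = 0, and the energy relation at c = e = 0 is
    k^4 = 0. *)
Lemma vector_sum_neq0 (R : realType) (k : R) (hk : 0 < k) x :
  kepler_orbits k x -> 0 < dot3 (vector_sum R x) (vector_sum R x).
Proof.
case: x => -[c e] h [ce]; rewrite !enorm_sqr => energy.
rewrite ltNge; apply/negP => /dot3_le0 [/=].
move=> /eqP; rewrite addr_eq0 => /eqP c0 /eqP; rewrite addr_eq0 => /eqP c1.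
move=> /eqP; rewrite addr_eq0 => /eqP c2.
have [|/= e0 e1 e2] := @dot3_le0 R (e 0 0, e 0 1, e 0 2%:R).
  by move: ce; rewrite dotv3E c0 c1 c2 /dot3 /=; lra.
move: energy; rewrite !dotv3E c0 c1 c2 e0 e1 e2 !oppr0 !mulr0 !addr0 mulr0.
by move/eqP; rewrite !sub0r mulrN1 opprK expf_eq0 gt_eqF.
Qed.

Theorem theorem2 (R : realType) (k : R) (hk : 0 < k) :
  ~ exists V : topologicalLmodType R,
      finite_dimensional V /\ homeomorphic V (set_type (kepler_orbits k)).
Proof.
move=> [V [_ [f [g [fK gK cf cg]]]]].
(* The collision orbits at energy 0, a copy of the sphere. *)
have rest (x : R * R * R) : dot3 x x = 1 -> kepler_orbits k (0, row3 R x, 0).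
  have [x0 x1 x2] := row3E R x; rewrite /dot3 => x1E.
  rewrite /kepler_orbits /= !enorm_sqr !dotv3E x0 x1 x2 x1E !mxE.
  by split; ring.
have vsum (x : R * R * R) : vector_sum R (0, row3 R x, 0) = x.
  case: x => -[a b] c; have [/= x0 x1 x2] := row3E R (a, b, c).
  by rewrite /vector_sum /= x0 x1 x2 !mxE !add0r.
pose orbit (e : R) (ee : e * e = 1) (u : R * R) : set_type (kepler_orbits k) :=
  exist _ (0, row3 R (stereo e u), 0) (mem_set (rest _ (stereo_dot3 e u ee))).
have corbit e ee : continuous (orbit e ee).
  apply: continuous_comp_initial.
  change (continuous (fun u =>
    (0 : 'rV[R]_3, row3 R (stereo e u), 0 : R))); continuity.
  by apply: continuous_after;
    [exact: continuous_row3|exact: continuous_stereo].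
have cval : continuous (fun z : set_type (kepler_orbits k) => set_val z).
  exact: initial_continuous.
apply: (no_sphere_contraction V (fun v => vector_sum R (set_val (f v)))
  (fun u => g (orbit 1 (mulr1 1) u))
  (fun u => g (orbit (-1) (etrans (mulrNN _ _) (mulr1 1)) u))).
- apply: (continuous_after _ _ (vector_sum R)).
    exact: continuous_vector_sum.
  by apply: continuous_after.
- by apply: continuous_after.
- by apply: continuous_after.
- by move=> v; apply: (vector_sum_neq0 R k hk); exact: set_valP.
- by move=> u; rewrite gK vsum.
- by move=> u; rewrite gK vsum.
- by move=> u u1; congr g; apply: val_inj; rewrite /= !stereo_circle.
Qed.
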